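(* Let $(\mathcal{A}_0,\boldsymbol{c}_0,F_0)$ be a known finite team technology for $n$ agents in which every agent has a zero-cost action, and assume there is $\boldsymbol{\alpha}\in\mathbb{R}_+^n$ with $\sum_i\alpha_i\le1$ and $\underline{u}(\boldsymbol{\alpha})>0$, where $$\underline{u}(\boldsymbol{\alpha})=\max_{\boldsymbol{a}\in\mathcal{A}_0}\left(\mathbb{E}_{F_0(\boldsymbol{a})}[y]-\sum_{i=1}^n\frac{c_{0,i}(a_i)}{\alpha_i}\right).$$ Let $$\boldsymbol{\alpha}^*\in\operatorname*{argmax}_{\{\boldsymbol{\alpha}\in\mathbb{R}_+^n:\ \sum_{i}\alpha_i\le1\}}\frac{\underline{u}(\boldsymbol{\alpha})\cdot\sum_{i=1}^n\alpha_i}{-\ln\left(1-\sum_{i=1}^n\alpha_i\right)}.$$ Consider the randomized linear contract with slope vector $\beta\cdot\boldsymbol{\alpha}^*$, where $\beta\in[0,1]$ is drawn according to the cumulative distribution function $$\tilde{G}^*(\beta)=\frac{\ln\left(1-\beta\sum_{i=1}^n\alpha_i^*\right)}{\ln\left(1-\sum_{i=1}^n\alpha_i^*\right)},\quad\beta\in[0,1]$$ (the point mass at $\beta=0$ if $\boldsymbol{\alpha}^*=\boldsymbol{0}$). Then this contract guarantees the principal an expected payoff of $$\frac{\underline{u}(\boldsymbol{\alpha}^* )\cdot\sum_{i=1}^n\alpha_i^*}{-\ln\left(1-\sum_{i=1}^n\alpha_i^*\right)},$$ i.e. for every technology $(\mathcal{A},\boldsymbol{c},F)$ consistent with $(\mathcal{A}_0,\boldsymbol{c}_0,F_0)$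 the principal's expected payoff is at least this value.
   Context: Agents are indexed by $I=\{1,\dots,n\}$. The output set $\mathcal{Y}\subset\mathbb{R}_+$ is finite. A team technology is a tuple $(\mathcal{A},\boldsymbol{c},F)$ where $\mathcal{A}=\times_{i=1}^n\mathcal{A}_i$ is a finite set of action profiles, $\boldsymbol{c}:\mathcal{A}\to\mathbb{R}_+^n$ gives the agents' costs with agent $i$'s cost depending only on their own action ($c_i(\boldsymbol{a})=c_i(a_i)$), and $F:\mathcal{A}\to\Delta(\mathcal{Y})$ gives the output distributions. The principal knows only a technology $(\mathcal{A}_0,\boldsymbol{c}_0,F_0)$; the true technology $(\mathcal{A},\boldsymbol{c},F)$ is consistent with it if $\mathcal{A}_0\subseteq\mathcal{A}$ (as products, i.e. $\mathcal{A}_{0,i}\subseteq\mathcal{A}_i$ for each $i$) and $(\boldsymbol{c},F)$ restricted to $\mathcal{A}_0$ equals $(\boldsymbol{c}_0,F_0)$. ''Every agent has a zero-cost action'' means that for each $i$ some action in $\mathcal{A}_{0,i}$ has cost $0$ for agent $i$. A contract is a function $\boldsymbol{w}:\mathcal{Y}\to\mathbb{R}_+^n$; it is linear with slope vector $\boldsymbol{\alpha}\in[0,1]^n$ if $w_i(y)=\alpha_iy$ for all $i,y$. Given a contract and a technology, the agents play a normal form game in which agent $i$'s utility at output $y$ and own action $a_i$ is $w_i(y)-c_i(a_i)$ (in expectation, $\mathbb{E}_{F(\boldsymbol{a})}[w_i(y)]-c_i(a_i)$); the principal's payoff is $y-\sum_iw_i(y)$ in expectation. For each realized contract, the agents play the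 (possibly mixed) Nash equilibrium that maximizes the principal's expected payoff. For a randomized contract, the technology is fixed before the contract is realized, and the principal's expected payoff is also averaged over the realization of the contract. Conventions: $0/0=0$ and $c/0=+\infty$ for $c>0$ in the terms $c_{0,i}(a_i)/\alpha_i$; the ratio $\frac{s}{-\ln(1-s)}$ with $s=\sum_i\alpha_i$ is understood as its limit $1$ at $s=0$ and as $0$ at $s=1$. *)

(* Defs.v *)
From HB Require Import structures.
From mathcomp Require Import all_boot all_order all_algebra finmap.
From mathcomp Require Import all_classical all_reals all_analysis.

Set Implicit Arguments.
Unset Strict Implicit.
Unset Printing Implicit Defensive.

Import Order.TTheory GRing.Theory Num.Theory.

Local Open Scope classical_set_scope.
Local Open Scope ring_scope.

Definition is_dist (R : realType) (X : finType) (p : X -> R) : Prop :=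
  (forall x, 0 <= p x) /\ \sum_x p x = 1.

Record technology (R : realType) (n : nat) (Y : {fset R}) := Technology {
  act : 'I_n -> finType;
  cost : forall i : 'I_n, act i -> R;
  outdist : {dffun forall i : 'I_n, act i} -> Y -> R;
  cost_ge0 : forall (i : 'I_n) (a : act i), 0 <= cost a;
  outdistP : forall a : {dffun forall i : 'I_n, act i}, is_dist (outdist a)
}.

Definition profile (R : realType) (n : nat) (Y : {fset R})
    (T : technology n Y) : finType :=
  {dffun forall i : 'I_n, act T i}.

(* [A0 \subset A] is rendered by injections [iota i : A0_i -> A_i], i.e. as
   inclusion up to the names of the actions. *)
Definition consistent (R : realType) (n : nat) (Y : {fset R})
    (T0 T : technology n Y) : Prop :=
  exists iota : forall i : 'I_n, act T0 i -> act T i,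
    [/\ forall i, injective (iota i),
        forall i (a : act T0 i), cost (iota i a) = cost a &
        forall (a : profile T0) (y : Y),
          outdist ([ffun i : 'I_n => iota i (a i)] : profile T) y = outdist a y].

Definition expected_output (R : realType) (n : nat) (Y : {fset R})
    (T : technology n Y) (a : profile T) : R :=
  \sum_(y : Y) outdist a y * val y.

Definition contract (R : realType) (n : nat) (Y : {fset R}) : Type :=
  Y -> 'I_n -> R.

Definition linear_contract (R : realType) (n : nat) (Y : {fset R})
    (alpha : 'I_n -> R) : contract n Y :=
  fun y i => alpha i * val y.

Definition agent_payoff (R : realType) (n : nat) (Y : {fset R})
    (T : technology n Y) (w : contract n Y) (i : 'I_n) (a : profile T) : R :=
  \sum_(y : Y) outdist a y * w y i - cost (a i).

Definition principal_payoff (R : realType) (n : nat) (Y : {fset R})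
    (T : technology n Y) (w : contract n Y) (a : profile T) : R :=
  \sum_(y : Y) outdist a y * (val y - \sum_i w y i).

Definition mixed_profile (R : realType) (n : nat) (Y : {fset R})
    (T : technology n Y) : Type :=
  forall i : 'I_n, act T i -> R.

Definition mixed_expectation (R : realType) (n : nat) (Y : {fset R})
    (T : technology n Y) (sigma : mixed_profile T) (g : profile T -> R) : R :=
  \sum_(a : profile T) (\prod_i sigma i (a i)) * g a.

Definition nash (R : realType) (n : nat) (Y : {fset R})
    (T : technology n Y) (w : contract n Y) (sigma : mixed_profile T) : Prop :=
  (forall i, is_dist (sigma i)) /\
  forall (i : 'I_n) (tau : act T i -> R), is_dist tau ->
    mixed_expectation (dfwith sigma i tau) (agent_payoff w i) <=
    mixed_expectation sigma (agent_payoff w i).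

(* The set of equilibria is nonempty and compact, so this supremum is the
   payoff of the principal-optimal equilibrium. *)
Definition principal_value (R : realType) (n : nat) (Y : {fset R})
    (T : technology n Y) (w : contract n Y) : \bar R :=
  ereal_sup [set (mixed_expectation sigma (principal_payoff w))%:E
            | sigma in nash (T := T) w].

(* [w omega] is the realized contract; the technology does not depend on
   [omega]. *)
Definition expected_value (R : realType) (n : nat) (Y : {fset R})
    (d : measure_display) (Omega : measurableType d) (P : probability Omega R)
    (w : Omega -> contract n Y) (T : technology n Y) : \bar R :=
  (\int[P]_omega principal_value T (w omega))%E.

Definition guarantees (R : realType) (n : nat) (Y : {fset R})
    (d : measure_display) (Omega : measurableType d) (P : probability Omega R)
    (w : Omega -> contract n Y) (T0 : technology n Y) (v : \bar R) : Prop :=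
  forall T : technology n Y, consistent T0 T -> (v <= expected_value P w T)%E.

(* c / alpha with 0 / 0 = 0 and c / 0 = +oo for c > 0 *)
Definition cost_ratio (R : realType) (c alpha : R) : \bar R :=
  if alpha == 0 then (if c == 0 then 0%E else +oo%E) else (c / alpha)%:E.

Definition u_low (R : realType) (n : nat) (Y : {fset R})
    (T0 : technology n Y) (alpha : 'I_n -> R) : \bar R :=
  \big[maxe/-oo%E]_(a : profile T0)
    ((expected_output a)%:E - \sum_i cost_ratio (cost (a i)) (alpha i))%E.

(* s / - ln (1 - s), extended by its limits at s = 0 and s = 1 *)
Definition log_ratio (R : realType) (s : R) : R :=
  if s == 0 then 1 else if s == 1 then 0 else s / - ln (1 - s).

Definition objective (R : realType) (n : nat) (Y : {fset R})
    (T0 : technology n Y) (alpha : 'I_n -> R) : \bar R :=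
  (u_low T0 alpha * (log_ratio (\sum_i alpha i))%:E)%E.

Definition feasible (R : realType) (n : nat) (alpha : 'I_n -> R) : Prop :=
  (forall i, 0 <= alpha i) /\ \sum_i alpha i <= 1.

Definition is_argmax (R : realType) (n : nat) (Y : {fset R})
    (T0 : technology n Y) (alpha : 'I_n -> R) : Prop :=
  feasible alpha /\
  forall alpha' : 'I_n -> R, feasible alpha' ->
    (objective T0 alpha' <= objective T0 alpha)%E.

(* For s = 0 this is, on [0, 1], the distribution function of the point mass
   at 0. The value at s = 1, where [ln 0 = 0] is junk, is irrelevant: the
   objective vanishes there, so a maximizer of a somewhere positive objective
   has s < 1. *)
Definition G_star (R : realType) (s beta : R) : R :=
  if s == 0 then 1 else ln (1 - beta * s) / ln (1 - s).

(* Main.v *)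
Require Import Defs.
From HB Require Import structures.
From mathcomp Require Import all_boot all_order all_algebra finmap.
From mathcomp Require Import all_classical all_reals all_analysis.
From mathcomp Require Import measurable_realfun ring lra.

(** Under slopes [t * alpha] the agents play a weighted potential game with
    potential [t * E(a) - C(a)], where [E] is expected output and
    [C(a) = \sum_i c_i(a_i) / alpha_i], so a maximizer [a_t] of the potential is
    a pure equilibrium. The maximum [V t] is convex, with subgradient [E(a_t)],
    [V 0 <= 0] and [V 1 >= u_low alpha]. With [s = \sum_i alpha_i], the
    principal's payoff [(1 - t * s) * E(a_t)] integrated against
    [dG = s / (- ln (1 - s)) / (1 - t * s) dt] is
    [s / (- ln (1 - s)) * (V 1 - V 0)]. For [s = 1] the guaranteed value
    is 0. *)

Set Implicit Arguments.
Unset Strict Implicit.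
Unset Printing Implicit Defensive.

Import Order.TTheory GRing.Theory Num.Theory.

Local Open Scope classical_set_scope.
Local Open Scope ring_scope.

(** Distributivity over a dependent family: each sum is moved to the tagged union of the [T_ i],
    where [bigA_distr_big_dep] applies, and the result returns through two bijections. It gives
    product distributions total mass 1. *)
Lemma prod_sum_dffun (R : comPzRingType) (I : finType) (T_ : I -> finType)
    (f : forall i : I, T_ i -> R) :
  \prod_i \sum_(x : T_ i) f i x =
  \sum_(b : {dffun forall i : I, T_ i}) \prod_i f i (b i).
Proof.
under eq_bigr do rewrite (big_tag f).
rewrite bigA_distr_big_dep.
rewrite (reindex (@dffun_of_fprod I T_)); last first.
  exact/onW_bij/dffun_of_fprod_bij.
rewrite (reindex (@of_family_tagged_with _ T_)) /=; last first.
  exact/onW_bij/of_family_tagged_with_bij.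
rewrite [LHS]big_sub /=.
apply: eq_bigr => -[g gP] _ /=.
apply: eq_bigr => i _; rewrite ffunE /fun_of_fprod /=.
by case: (g i) ('forall_eqP _ _) => //= j t; case: _ /; rewrite untagE.
Qed.

(** * Pure equilibria of the weighted potential game *)

Section game.
Variables (R : realType) (n : nat) (Y : {fset R}) (T : technology n Y).
Implicit Types (a b : profile T) (w : Defs.contract n Y).

Definition pure_profile a : mixed_profile T := fun i x => (x == a i)%:R.
Arguments pure_profile : clear implicits.

Lemma is_dist_pure (a : profile T) i : is_dist (pure_profile a i).
Proof.
split=> [x|]; first exact: ler0n.
rewrite (bigD1 (a i)) //= big1 ?addr0 /pure_profile ?eqxx // => x.
by move/negbTE->.
Qed.

Lemma sum_mixed_profile (sigma : mixed_profile T) :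
  (forall i, is_dist (sigma i)) ->
  \sum_(b : profile T) \prod_i sigma i (b i) = 1.
Proof.
move=> ds; rewrite -(prod_sum_dffun sigma) big1 // => i _.
by case: (ds i).
Qed.

Lemma mixed_expectation_pure a (g : profile T -> R) :
  mixed_expectation (pure_profile a) g = g a.
Proof.
rewrite /mixed_expectation (bigD1 a) //= big1 => [|i _]; last first.
  by rewrite /pure_profile eqxx.
rewrite mul1r big1 ?addr0 // => b nba.
have [i bai] : exists i, b i != a i.
  apply/existsP; apply: contraR nba; rewrite negb_exists => /forallP ba.
  by apply/eqP/ffunP => i; move: (ba i); rewrite negbK => /eqP.
by rewrite (bigD1 i) //= /pure_profile (negbTE bai) !mul0r.
Qed.

(** A mixed deviation of agent [i] yields an average of payoffs at profiles agreeing with [a] off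
    [i], so comparing pure deviations suffices. *)
Lemma nash_pure w a :
  (forall i b, (forall j, j != i -> b j = a j) ->
    agent_payoff w i b <= agent_payoff w i a) ->
  nash w (pure_profile a).
Proof.
move=> dev; split=> [i|i tau dtau]; first exact: is_dist_pure.
rewrite mixed_expectation_pure.
set sigma : mixed_profile T := dfwith _ _ _.
have dsigma j : is_dist (sigma j).
  rewrite /sigma; case: mathcomp_extra.dfwithP => // k _.
  exact: is_dist_pure.
rewrite -[leRHS]mul1r -(sum_mixed_profile dsigma) mulr_suml.
apply: ler_sum => b _.
have [w0|wn0] := eqVneq (\prod_j sigma j (b j)) 0; first by rewrite w0 !mul0r.
apply: ler_wpM2l; first by apply: prodr_ge0 => j _; case: (dsigma j).
apply: dev => j ji; apply/eqP; apply: contraNT wn0 => bj.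
(* A profile differing from [a] at some [j != i] has weight 0. *)
rewrite (bigD1 j) //= /sigma dfwithout 1?eq_sym //.
by rewrite /pure_profile (negbTE bj) mul0r.
Qed.

(* The game under slopes [t * alpha] is a weighted potential game: agent i's
   utility divided by alpha_i varies with a_i as this potential. Where
   alpha_i = 0 the division gives 0, and admissibility forces zero cost. *)
Definition potential (alpha : 'I_n -> R) (t : R) a : R :=
  t * expected_output a - \sum_i cost (a i) / alpha i.

(** These are the profiles at which every [cost_ratio] is finite. *)
Definition admissible (alpha : 'I_n -> R) a : bool :=
  [forall i, (alpha i == 0) ==> (cost (a i) == 0)].

Lemma agent_payoff_linear (alpha : 'I_n -> R) i a :
  agent_payoff (linear_contract alpha) i a =
  alpha i * expected_output a - cost (a i).
Proof.
rewrite /agent_payoff /linear_contract /expected_output mulr_sumr.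
by congr (_ - _); apply: eq_bigr => y _; rewrite mulrCA.
Qed.

Lemma principal_payoff_linear (alpha : 'I_n -> R) a :
  principal_payoff (linear_contract alpha) a =
  (1 - \sum_i alpha i) * expected_output a.
Proof.
rewrite /principal_payoff /linear_contract /expected_output mulr_sumr.
by apply: eq_bigr => y _; rewrite -mulr_suml -[X in X - _]mul1r -mulrBl mulrCA.
Qed.

Lemma nash_potential (alpha : 'I_n -> R) t a :
  (forall i, 0 <= alpha i) -> admissible alpha a ->
  (forall b, admissible alpha b ->
    potential alpha t b <= potential alpha t a) ->
  nash (linear_contract (fun i => t * alpha i)) (pure_profile a).
Proof.
move=> alpha0 adm maxa; apply: nash_pure => i b bE.
rewrite !agent_payoff_linear.
(* With slope 0 the agent is paid nothing and already acts at zero cost, so no deviation gains. *)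
have [ai0|ai0] := eqVneq (alpha i) 0.
  move/forallP/(_ i): adm; rewrite ai0 eqxx /= => /eqP->.
  by rewrite mulr0 !mul0r !sub0r oppr0 oppr_le0 cost_ge0.
have aip : 0 < alpha i by rewrite lt_neqAle eq_sym ai0 alpha0.
(* The deviation changes only a coordinate of positive slope, so [b] competes in the maximum. *)
have admb : admissible alpha b.
  apply/forallP => j; have [->|ji] := eqVneq j i; first by rewrite (negbTE ai0).
  by rewrite bE //; move/forallP: adm.
have := maxa b admb.
rewrite /potential (bigD1 i) //= [in leRHS](bigD1 i) //=.
rewrite (eq_bigr (fun j => cost (a j) / alpha j)) => [|j ji];
  last by rewrite bE.
rewrite !opprD !addrA lerD2r -(ler_pM2l aip) !mulrBr.
by rewrite ![alpha i * (_ / _)]mulrC !divfK //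
  ![alpha i * (t * _)]mulrCA !mulrA.
Qed.

Lemma le_principal_value (alpha : 'I_n -> R) t a :
  (forall i, 0 <= alpha i) -> admissible alpha a ->
  (forall b, admissible alpha b ->
    potential alpha t b <= potential alpha t a) ->
  (((1 - t * \sum_i alpha i) * expected_output a)%:E <=
    principal_value T (linear_contract (fun i => t * alpha i)%R))%E.
Proof.
move=> alpha0 adm maxa; apply: ereal_sup_ubound.
exists (pure_profile a); first exact: nash_potential.
by rewrite mixed_expectation_pure principal_payoff_linear -mulr_sumr.
Qed.

Lemma expected_output_ge0 a :
  (forall y : R, y \in Y -> 0 <= y) -> 0 <= expected_output a.
Proof.
move=> Y0; apply: sumr_ge0 => y _; apply: mulr_ge0; last exact/Y0/valP.
by case: (outdistP a).
Qed.

End game.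

(** * Integration against the law given by [G_star] *)

(** A nonnegative integral is a supremum over the simple functions below the integrand, and a larger
    integrand admits more of them. *)
Lemma ge0_le_integral_nonmeasurable d (T : measurableType d) (R : realType)
    (mu : {measure set T -> \bar R}) (f g : T -> \bar R) :
  (forall x, 0 <= f x)%E -> (forall x, f x <= g x)%E ->
  (\int[mu]_x f x <= \int[mu]_x g x)%E.
Proof.
move=> f0 fg; rewrite !ge0_integralTE // => [|x]; last first.
  exact: le_trans (f0 x) (fg x).
apply: ereal_sup_le => _ [h hf <-]; exists h => // x.
exact: le_trans (hf x) (fg x).
Qed.

Lemma lee_inv_nat (R : realType) (x M : R) (y : \bar R) : 0 <= M ->
  (forall N : nat, (x - M / N.+1%:R)%:E <= y)%E -> (x%:E <= y)%E.
Proof.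
move=> M0 H; apply/lee_addgt0Pr => e e0.
(* The denominator [M + 1] stays positive when [M = 0]. *)
have /ltr_add_invr[k] : 0 < e / (M + 1) by rewrite divr_gt0 //; lra.
rewrite add0r ltr_pdivlMr ?ltr_wpDl // => ke.
have k0 : 0 < k.+1%:R^-1 :> R by rewrite invr_gt0 ltr0n.
apply: le_trans (leeD2r e%:E (H k)); rewrite lee_fin.
by move: ke k0; set z := _^-1 => ke z0; lra.
Qed.

(** A discrete form of [(1 - t * s) dG = s / - ln (1 - s) dt] with a quadratic error. It follows
    from [ln z <= z - 1] at [z = (1 - y * s) / (1 - x * s)], then [1 - x * s >= 1 - s]. *)
Lemma G_star_step (R : realType) (s x y : R) :
  0 < s < 1 -> 0 <= x -> x <= y -> y <= 1 ->
  s / - ln (1 - s) * ((y - x) * (1 - (y - x) * (s / (1 - s)))) <=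
  (1 - y * s) * (G_star s y - G_star s x).
Proof.
move=> /andP[s0 s1] x0 xy y1.
have L0 : 0 < - ln (1 - s) by rewrite oppr_gt0; apply: ln_lt0; lra.
have xs : x * s <= s by rewrite ger_pMl //; lra.
have ys : y * s <= s by rewrite ger_pMl.
have xp : 0 < 1 - x * s by lra.
have yp : 0 < 1 - y * s by lra.
rewrite /G_star gt_eqF //.
have -> : ln (1 - y * s) / ln (1 - s) - ln (1 - x * s) / ln (1 - s) =
   (ln (1 - x * s) - ln (1 - y * s)) / - ln (1 - s).
  by rewrite invrN mulrN -mulNr opprB mulrBl.
rewrite [leRHS]mulrA [leLHS]mulrAC ler_pM2r ?invr_gt0 //.
have zE : (1 - y * s) / (1 - x * s) = 1 + - ((y - x) * s / (1 - x * s)).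
  by field; rewrite gt_eqF.
have ln_le : (y - x) * s / (1 - x * s) <= ln (1 - x * s) - ln (1 - y * s).
  rewrite -[leRHS]opprB lerNr -ln_div ?posrE // zE le_ln1Dx //.
  by rewrite -subr_gt0 opprK addrC -zE divr_gt0.
apply: le_trans (ler_wpM2l (ltW yp) ln_le).
have -> : (1 - y * s) * ((y - x) * s / (1 - x * s)) =
    s * ((y - x) * (1 - (y - x) * (s / (1 - x * s)))).
  by field; rewrite gt_eqF.
apply: ler_wpM2l; first exact: ltW.
apply: ler_wpM2l; first by rewrite subr_ge0.
rewrite lerD2l lerN2; apply: ler_wpM2l; first by rewrite subr_ge0.
by apply: ler_wpM2l; [exact: ltW|rewrite lef_pV2 ?posrE; lra].
Qed.

Section randomization.
Context {R : realType} {d : measure_display} {Omega : measurableType d}.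
Variables (P : probability Omega R) (beta : {RV P >-> R}).

Lemma cdf_preimage_itvoc (x y : R) : x <= y ->
  (P (beta @^-1` `]x, y]) = cdf beta y - cdf beta x)%E.
Proof.
move=> xy; rewrite /cdf -[X in (X - _)%E]/(P (beta @^-1` `]-oo, y])).
rewrite -[X in (_ - X)%E]/(P (beta @^-1` `]-oo, x])).
have -> : beta @^-1` `]x, y] = beta @^-1` `]-oo, y] `\` beta @^-1` `]-oo, x].
  apply/seteqP; split=> w /=; rewrite !in_itv /=.
    by move=> /andP[xw ->]; split=> //; apply/negP; rewrite -ltNge.
  by move=> [->] /negP; rewrite -ltNge => ->.
have mb z : measurable (beta @^-1` `]-oo, z]) by exact: measurable_funPTI.
rewrite measureD //; last first.
  exact: le_lt_trans (probability_le1 _ (mb y)) (ltry 1).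
congr (_ - P _)%E; apply/seteqP; split=> [w []//|w /= xw]; split=> //=.
by move: xw; rewrite !in_itv /= => /le_trans; apply.
Qed.

(* The slope [e] is nondecreasing, so on each cell of a uniform grid [e] is at
   least the increment of [V] over the previous cell divided by the mesh. Only
   step functions below [f] are integrated: [f] need not be measurable. *)
Lemma integral_subgradient (s : R) (V e : R -> R) (f : Omega -> \bar R) :
  0 < s < 1 ->
  (forall omega, 0 <= beta omega <= 1) ->
  (forall x, 0 <= x <= 1 -> cdf beta x = (G_star s x)%:E) ->
  (forall t, 0 <= e t) ->
  (forall t t', V t + (t' - t) * e t <= V t') ->
  (forall omega, ((1 - beta omega * s) * e (beta omega))%:E <= f omega)%E ->
  ((s / - ln (1 - s) * (V 1 - V 0))%:E <= \int[P]_omega f omega)%E.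
Proof.
move=> s01 beta01 cdfE e0 subgrad fle; have /andP[s0 s1] := s01.
(* Add the subgradient inequalities at [t] and at [t']. *)
have e_homo t t' : t <= t' -> e t <= e t'.
  rewrite le_eqVlt => /predU1P[->//|tt'].
  have := subgrad t t'; have := subgrad t' t => H1 H2.
  have : (t' - t) * e t <= (t' - t) * e t' by lra.
  by rewrite ler_pM2l // subr_gt0.
set K := s / - ln (1 - s).
have K0 : 0 <= K.
  by rewrite divr_ge0 // ltW // oppr_gt0; apply: ln_lt0; lra.
set c := s / (1 - s).
have c0 : 0 <= c by rewrite divr_ge0 //; lra.
(* In this constant [K * c * e 1] collects the quadratic errors of the cells, and [K * e 1] pays for
   the increment of [V] over the last cell, which the sum misses. *)
apply: (@lee_inv_nat _ _ (K * (1 + c) * e 1)) => [|N].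
  by rewrite mulr_ge0 // mulr_ge0 // addr_ge0.
set dl : R := N.+1%:R^-1.
have dl0 : 0 < dl by rewrite invr_gt0 ltr0n.
pose t (k : nat) : R := k%:R * dl.
have tS k : t k.+1 = t k + dl by rewrite /t -natr1; ring.
have t0 k : 0 <= t k by rewrite mulr_ge0 // ltW.
have t_homo k l : (k <= l)%N -> t k <= t l.
  by move=> kl; rewrite ler_pM2r // ler_nat.
have tN1 : t N.+1 = 1 by rewrite /t divff // pnatr_eq0.
have t1 k : (k <= N.+1)%N -> t k <= 1 by move=> /t_homo; rewrite tN1.
(* On [A k] the factor [1 - beta * s] is bounded below at the right end and [e] at the left end. The
   cells start at [t 1] because [e (t k.+1)] is paired with the increment of [V] from [t k] to
   [t k.+1]; for [beta] at most [t 1] the step function is 0. *)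
pose a k := (1 - t k.+2 * s) * e (t k.+1).
pose A k := beta @^-1` `]t k.+1, t k.+2].
have ts k : (k <= N.+1)%N -> 0 <= 1 - t k * s.
  move=> /t1 tk; have : t k * s <= s by rewrite ger_pMl.
  lra.
have a0 (k : 'I_N) : 0 <= a k by rewrite mulr_ge0 ?ts ?ltnS //; exact: ltn_ord.
have mA k : measurable (A k) by exact: measurable_funPTI.
have step_le omega :
    (\sum_(k < N) (a k * \1_(A k) omega)%:E <= f omega)%E.
  apply: le_trans (fle omega); rewrite sumEFin lee_fin.
  have [b0 b1] := andP (beta01 omega).
  have bs : 0 <= 1 - beta omega * s.
    have : beta omega * s <= s by rewrite ger_pMl.
    lra.
  (* The cells are disjoint, so at most one term is nonzero. *)
  have [[k Ak]|nA] := pselect (exists k : 'I_N, A k omega); last first.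
    rewrite big1 ?mulr_ge0 // => k _.
    rewrite indicE memNset ?mulr0 // => Ak; apply: nA; by exists k.
  have [xk ky] : t k.+1 < beta omega /\ beta omega <= t k.+2.
    by apply/andP; move: Ak; rewrite /A /= in_itv.
  rewrite (bigD1 k) //= big1 => [|l lk].
    rewrite indicE mem_set // mulr1 addr0 /a ler_pM ?ts ?ltnS // ?ltn_ord //.
      by rewrite lerD2l lerN2 ler_pM2r.
    exact/e_homo/ltW.
  rewrite indicE memNset ?mulr0 // /A /= in_itv /= => /andP[xl ly].
  case: (ltngtP l k) => [lk'|kl'|/val_inj lk']; last by rewrite lk' eqxx in lk.
    have : t l.+2 <= t k.+1 by exact: t_homo.
    lra.
  have : t k.+2 <= t l.+1 by exact: t_homo.
  lra.
have step_ge0 omega : (0 <= \sum_(k < N) (a k * \1_(A k) omega)%:E)%E.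
  by apply: sume_ge0 => k _; rewrite lee_fin mulr_ge0 // indicE ler0n.
apply: le_trans (ge0_le_integral_nonmeasurable _ step_ge0 step_le).
rewrite ge0_integral_sum //=; last 2 first.
- move=> k; apply/measurable_EFinP/measurable_funM => //;
  exact: measurable_indic.
- by move=> k omega _; rewrite lee_fin mulr_ge0 // indicE ler0n.
rewrite (eq_bigr (fun k : 'I_N =>
    (a k * (G_star s (t k.+2) - G_star s (t k.+1)))%:E)) => [|k _]; last first.
  under eq_integral do rewrite EFinM.
  rewrite ge0_integralZl_EFin //=; last first.
    by apply/measurable_EFinP; exact: measurable_indic.
  rewrite integral_indic // setIT.
  rewrite [X in (_ * X)%E]
    (_ : _ = cdf beta (t k.+2) - cdf beta (t k.+1))%E; last first.
    exact/cdf_preimage_itvoc/t_homo.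
  rewrite !cdfE ?t0 ?t1 ?ltnS //; last exact: ltnW.
rewrite sumEFin lee_fin.
have cell (k : 'I_N) :
    K * (V (t k.+1) - V (t k)) - K * c * e 1 * dl ^+ 2 <=
    a k * (G_star s (t k.+2) - G_star s (t k.+1)).
  have kN := ltn_ord k.
  have := @G_star_step _ s (t k.+1) (t k.+2) s01 (t0 _).
  rewrite -/K -/c => /(_ (t_homo _ _ (leqnSn _)) (t1 k.+2 kN)).
  rewrite (_ : t k.+2 - t k.+1 = dl); last by rewrite tS addrAC subrr add0r.
  move=> /(ler_wpM2r (e0 (t k.+1))).
  rewrite [leRHS]mulrAC -/(a k) => /(le_trans _); apply.
  have V_le : V (t k.+1) - V (t k) <= dl * e (t k.+1).
    have := subgrad (t k.+1) (t k).
    rewrite (_ : t k - t k.+1 = - dl); first by lra.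
    by rewrite tS; ring.
  have e_le : K * c * dl ^+ 2 * e (t k.+1) <= K * c * dl ^+ 2 * e 1.
    by rewrite (ler_wpM2l (mulr_ge0 (mulr_ge0 K0 c0) (sqr_ge0 _))) // e_homo //
      t1 // ltnW.
  have := ler_wpM2l K0 V_le; lra.
apply: le_trans (ler_sum _ (fun k _ => cell k)).
rewrite big_split /= -mulr_sumr sumr_const card_ord.
rewrite -(big_mkord xpredT (fun k => V (t k.+1) - V (t k))) telescope_sumr //.
(* Since [N * dl = t N <= 1], the [N] errors of order [dl ^+ 2] add up to order [dl]. *)
have Nd : - (K * c * e 1 * dl ^+ 2) *+ N = - (K * c * e 1 * dl * t N).
  by rewrite -mulr_natr /t; ring.
rewrite Nd.
have VN : V 1 - dl * e 1 <= V (t N).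
  have := subgrad 1 (t N).
  rewrite (_ : t N - 1 = - dl); first by lra.
  by rewrite -tN1 tS; ring.
have tN_le : K * c * e 1 * dl * t N <= K * c * e 1 * dl.
  by rewrite ler_piMr ?t1 // mulr_ge0 ?(ltW dl0) // mulr_ge0 // mulr_ge0.
have t00 : t 0 = 0 by rewrite /t mul0r.
rewrite t00.
have := ler_wpM2l K0 VN; lra.
Qed.

End randomization.

(** * From the known technology to the guarantee *)

(** A known profile keeps its costs and output under [iota]. If admissible, its term in [u_low] is
    the potential at [t = 1] of its image; otherwise the term is [-oo]. *)
Lemma u_low_le_potential (R : realType) (n : nat) (Y : {fset R})
    (T0 T : technology n Y) (alpha : 'I_n -> R) (v : R) :
  (forall i, 0 <= alpha i) -> consistent T0 T ->
  (forall b : profile T, admissible alpha b -> potential alpha 1 b <= v) ->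
  (u_low T0 alpha <= v%:E)%E.
Proof.
move=> alpha0 [iota [_ costE outE]] maxv.
apply: bigmax_le => [|a _]; first exact: leNye.
have [adm|] := boolP (admissible alpha a); last first.
  rewrite negb_forall => /existsP[i]; rewrite negb_imply => /andP[ai0 ci0].
  rewrite (bigD1 i) //= {1}/cost_ratio ai0 (negbTE ci0) addye ?leNye //.
  (* The remaining summands are nonnegative, so their sum is not [-oo] and adding [+oo] gives
     [+oo]. *)
  rewrite gt_eqF //; apply: lt_le_trans (ltNyr 0) _; apply: sume_ge0 => j _.
  rewrite /cost_ratio; do 2?case: ifP => // _.
  by rewrite lee_fin divr_ge0 // cost_ge0.
pose b : profile T := [ffun i => iota i (a i)].
have bE i : cost (b i) = cost (a i) by rewrite ffunE costE.
have -> : (\sum_i cost_ratio (cost (a i)) (alpha i))%E =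
    (\sum_i cost (b i) / alpha i)%:E.
  rewrite -sumEFin; apply: eq_bigr => i _; rewrite bE /cost_ratio.
  case: ifPn => // ai0; move/forallP/(_ i): adm; rewrite ai0 /= => ->.
  by rewrite (eqP ai0) invr0 mulr0.
have -> : expected_output a = expected_output b.
  by apply: eq_bigr => y _; rewrite outE.
rewrite -EFinB lee_fin -[expected_output b]mul1r; apply: maxv.
by apply/forallP => i; rewrite bE; move/forallP: adm.
Qed.

Unset Implicit Arguments.

Theorem theorem5p1 (R : realType) (n : nat) (Y : {fset R})
    (Y_ge0 : forall y : R, y \in Y -> 0 <= y)
    (T0 : technology n Y)
    (zero_cost : forall i : 'I_n, exists a : act T0 i, cost a = 0)
    (u_pos : exists alpha : 'I_n -> R,
       feasible alpha /\ (0 < u_low T0 alpha)%E)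
    (alpha : 'I_n -> R) (alpha_max : is_argmax T0 alpha)
    (d : measure_display) (Omega : measurableType d) (P : probability Omega R)
    (beta : {RV P >-> R})
    (beta_01 : forall omega : Omega, 0 <= beta omega <= 1)
    (beta_cdf : forall x : R, 0 <= x <= 1 ->
       cdf beta x = (G_star (\sum_i alpha i) x)%:E) :
  guarantees P
    (fun omega => linear_contract (fun i => beta omega * alpha i))
    T0
    (u_low T0 alpha * (log_ratio (\sum_i alpha i))%:E)%E.
Proof.
move=> T consT; have [[alpha0 s_le1] _] := alpha_max.
set s := \sum_i alpha i in beta_cdf s_le1 *.
have s_ge0 : 0 <= s by apply: sumr_ge0.
(* A profile of zero-cost actions is admissible for any slopes and makes the argmax well defined. *)
have [a0 adm0] : exists a : profile T, admissible alpha a.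
  have [iota [_ costE _]] := consT.
  exists [ffun i => iota i (projT1 (cid (zero_cost i)))].
  apply/forallP => i; apply/implyP => _; rewrite ffunE costE.
  by case: cid => a /= ->.
pose sel t := [arg max_(a > a0 | admissible alpha a) potential alpha t a]%O.
have sel_adm t : admissible alpha (sel t).
  by rewrite /sel; case: arg_maxP.
have sel_max t (b : profile T) : admissible alpha b ->
    potential alpha t b <= potential alpha t (sel t).
  by rewrite /sel; case: arg_maxP => // a _ + admb => /(_ b admb).
pose e t := expected_output (sel t).
pose V t := potential alpha t (sel t).
have e0 t : 0 <= e t by exact: expected_output_ge0.
have value_ge t : (((1 - t * s) * e t)%:E <=
    principal_value T (linear_contract (fun i => t * alpha i)%R))%E.
  by apply: le_principal_value => // b; exact: sel_max.
have u_low_le : (u_low T0 alpha <= (V 1)%:E)%E.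
  by apply: (u_low_le_potential alpha0 consT) => b; exact: sel_max.
rewrite /expected_value /log_ratio.
(* For [s = 0] all slopes vanish, so every realized contract is the zero contract and the constant
   [V 1 = e 1] bounds its value from below. *)
have [s0|s_neq0] := eqVneq s 0.
  have alphaE i : alpha i = 0.
    have : \sum_j alpha j == 0 by rewrite -/s s0.
    by rewrite psumr_eq0 // => /allP/(_ i (mem_index_enum _))/eqP.
  rewrite mule1; apply: le_trans u_low_le _.
  have V1E : V 1 = (1 - 1 * s) * e 1.
    rewrite /V /potential big1 => [|i _]; last by rewrite alphaE invr0 mulr0.
    by rewrite s0 mulr0 !subr0.
  rewrite -[leLHS]mule1 -(@probability_setT _ _ _ P) -integral_cst //.
  apply: ge0_le_integral_nonmeasurable => omega /=.
    by rewrite lee_fin V1E s0 mulr0 subr0 mul1r.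
  rewrite V1E; apply: le_trans (value_ge 1) _.
  rewrite (_ : (fun i => 1 * alpha i) = (fun i => beta omega * alpha i)) //.
  by apply/funext => i; rewrite alphaE !mulr0.
have [s1|s_neq1] := eqVneq s 1.
  rewrite mule0; apply: integral_ge0 => omega _.
  apply: le_trans (value_ge (beta omega)); rewrite lee_fin mulr_ge0 //.
  by rewrite s1 mulr1 subr_ge0; case/andP: (beta_01 omega).
have s01 : 0 < s < 1 by rewrite !lt_neqAle eq_sym s_neq0 s_neq1 s_ge0.
apply: (@le_trans _ _ (s / - ln (1 - s) * (V 1 - V 0))%:E).
  rewrite [X in (_ <= X%:E)%E]mulrC [leRHS]EFinM; apply: lee_wpmul2r.
    rewrite lee_fin divr_ge0 // oppr_ge0 ln_le0 //; lra.
  (* [V 0] is minus a sum of nonnegative terms, so [V 1 <= V 1 - V 0]. *)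
  apply: le_trans u_low_le _; rewrite lee_fin lerDl oppr_ge0 /V /potential.
  rewrite mul0r sub0r oppr_le0; apply: sumr_ge0 => i _.
  by rewrite divr_ge0 // cost_ge0.
apply: (integral_subgradient (e := e)) => // t t'.
(* [sel t] competes at [t'], where its potential is [V t + (t' - t) * e t]. *)
apply: le_trans (sel_max t' _ (sel_adm t)).
rewrite /V /potential /e; lra.
Qed.
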